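(* Let $m\ge1$ be an integer. For all integers $n\ge0$ and $k\ge0$, $$\mathsf S_m(n+m,k)=\sum_{j=0}^n\binom nj\,m^{\,n-j}\,\mathsf S_m(j,k-m).$$
   Context: The $m$-Stirling numbers of the second kind $\mathsf S_m(n,k)$ are defined for integers $n,k\ge0$ by $\mathsf S_m(0,k)=\delta_{0,k}$, the convention $\mathsf S_m(n,k)=0$ for $k<0$, and the recurrence $\mathsf S_m(n+1,k)=m\lfloor k/m\rfloor\,\mathsf S_m(n,k)+\mathsf S_m(n,k-1)$. *)

(* Defs.v *)
From mathcomp Require Import all_boot all_order all_algebra.

Set Implicit Arguments.
Unset Strict Implicit.
Unset Printing Implicit Defensive.

Import GRing.Theory.

(* The lower index is an integer, so that the convention S_m(n, k) = 0 for
   k < 0 applies to genuinely negative indices such as k - 1 and k - m, with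
   no truncated subtraction. [j %/ m] is the floor of j / m for m > 0. *)
Fixpoint mstirling (m n : nat) (k : int) : nat :=
  match k with
  | Posz j =>
      if n is n'.+1 then
        m * (j %/ m) * mstirling m n' k + mstirling m n' (k - 1)%R
      else (j == 0)
  | Negz _ => 0
  end.

Lemma mstirling0 (m k : nat) : mstirling m 0 k = (k == 0).
Proof. by []. Qed.

Lemma mstirling_neg (m n : nat) (k : int) : (k < 0)%R -> mstirling m n k = 0.
Proof. by case: k => // j _; case: n. Qed.

Lemma mstirlingS (m n k : nat) :
  mstirling m n.+1 k =
    m * (k %/ m) * mstirling m n k + mstirling m n (k%:Z - 1)%R.
Proof. by []. Qed.

(* Main.v *)
Require Import Defs.
From mathcomp Require Import all_boot all_order all_algebra.
From mathcomp Require Import ring zify.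

(** In the recurrence for the m-Stirling numbers the lower index [k] carries
    the weight [m * (k %/ m)], and raising [k] by [m] raises that weight by
    exactly [m].  So the array [S(n + m, k + m)] satisfies the recurrence of
    [S(n, k)] with every weight increased by the constant [m].  Adding a
    constant to all weights is what the binomial transform
    [f |-> \sum_j 'C(n, j) * m ^ (n - j) * f j] does: by Pascal's rule
    ([binomial_transformS]) the transform at [n + 1] is [m] times the transform
    at [n] plus the transform at [n] of the shifted sequence, and the shifted
    sequence is expanded by the original recurrence.

    Both sides thus obey one recurrence in [n], and it remains to compare their
    initial values at [n = 0] and at negative [k].  These agree because the
    array is unitriangular ([mstirling_diag]) and because the first [m] weights
    vanish, so that the columns [k < m] are those of the identity matrix
    ([mstirling_small]). *)

Definition binomial_transform (m : nat) (f : nat -> nat) (n : nat) : nat :=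
  \sum_(0 <= j < n.+1) 'C(n, j) * m ^ (n - j) * f j.

Lemma eq_binomial_transform (m : nat) (f g : nat -> nat) (n : nat) :
  f =1 g -> binomial_transform m f n = binomial_transform m g n.
Proof. by move=> fg; apply: eq_bigr => j _; rewrite fg. Qed.

Lemma binomial_transform0 (m : nat) (f : nat -> nat) :
  binomial_transform m f 0 = f 0.
Proof. by rewrite /binomial_transform big_nat1 bin0 !mul1n. Qed.

Lemma binomial_transform_lin (m a : nat) (f g : nat -> nat) (n : nat) :
  binomial_transform m (fun j => a * f j + g j) n =
    a * binomial_transform m f n + binomial_transform m g n.
Proof.
rewrite /binomial_transform big_distrr -big_split /=.
by apply: eq_bigr => j _; ring.
Qed.

(** With [E] the shift of sequences, the transform is [(m + E) ^ n] evaluated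
    at index 0; this is [(m + E) ^ n.+1 = m (m + E) ^ n + (m + E) ^ n E]. *)
Lemma binomial_transformS (m : nat) (f : nat -> nat) (n : nat) :
  binomial_transform m f n.+1 =
    m * binomial_transform m f n + binomial_transform m (f \o succn) n.
Proof.
rewrite /binomial_transform big_nat_recl // bin0 subn0 mul1n.
under eq_bigr => j _ do rewrite binS subSS 2!mulnDl.
rewrite big_split /= addnA; congr (_ + _).
(* The last term has binomial coefficient 'C(n, n.+1) = 0. *)
rewrite big_nat_recr //= bin_small // !mul0n addn0.
rewrite [in RHS]big_nat_recl // bin0 subn0 mul1n mulnDr mulnA -expnS.
congr (_ + _); rewrite big_distrr /= !big_nat; apply: eq_bigr => j /andP[_ jn].
have -> : n - j = (n - j.+1).+1 by lia.
by rewrite expnS; ring.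
Qed.

Lemma mstirling_diag (m n k : nat) : mstirling m n (n + k)%N%:Z = (k == 0).
Proof.
elim: n k => [//|n IHn] k.
rewrite addSn mstirlingS -addnS IHn muln0 add0n addnS.
have -> : ((n + k).+1%:Z - 1 = (n + k)%N%:Z)%R by lia.
exact: IHn.
Qed.

Lemma mstirling_small (m n : nat) (k : int) :
  (k < m%:Z)%R -> mstirling m n k = (k == Posz n).
Proof.
elim: n k => [|n IHn] [k|k] ltkm; [by [] | exact: mstirling_neg | | by []].
rewrite mstirlingS divn_small; last by lia.
rewrite muln0 mul0n add0n IHn; last by lia.
by congr nat_of_bool; lia.
Qed.

(** The lower index ranges over the integers because the induction on [n] uses
    the hypothesis at [k - 1], including at [k = 0]. *)
Lemma mstirling_shift (m n : nat) (k : int) : 0 < m ->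
  mstirling m (n + m) (k + m%:Z)%R =
    binomial_transform m (fun j => mstirling m j k) n.
Proof.
move=> m_gt0; elim: n k => [|n IHn] [k|k].
- by rewrite binomial_transform0 -PoszD add0n addnC mstirling_diag.
- by rewrite binomial_transform0 mstirling_small ?mstirling_neg //; lia.
- rewrite addSn -PoszD mstirlingS divnDr // divnn m_gt0 binomial_transformS.
  rewrite (@eq_binomial_transform _ _ _ _ (fun j => mstirlingS m j k)).
  rewrite binomial_transform_lin -!IHn PoszD.
  have -> : (k%:Z + m%:Z - 1 = k%:Z - 1 + m%:Z)%R by lia.
  by rewrite -[nat_of_bool true]/1; ring.
- rewrite /binomial_transform big1 => [|j _]; last by rewrite mstirling_neg ?muln0.
  by rewrite mstirling_small; lia.
Qed.

Theorem theorem7p3 (m : nat) (hm : 1 <= m) (n k : nat) :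
  mstirling m (n + m) k%:Z =
    \sum_(0 <= j < n.+1)
       'C(n, j) * m ^ (n - j) * mstirling m j (k%:Z - m%:Z)%R.
Proof. by rewrite -[in LHS](GRing.subrK m%:Z%R k%:Z%R) mstirling_shift. Qed.
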